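(* Let $G$ be an $r$-uniform hypergraph with no isolated vertices, with minimum degree $\delta$ and maximum degree $\Delta$. For real $p>r$ define \[ f_G(p)=\bigg(\frac{\lambda^{(p)}(G)}{\Delta}\bigg)^{p/(p-r)},\qquad g_G(p)=\bigg(\frac{\lambda^{(p)}(G)}{\delta}\bigg)^{p/(p-r)}. \] Then $f_G$ is non-decreasing in $p$ on $(r,\infty)$ and $g_G$ is non-increasing in $p$ on $(r,\infty)$.
   Context: An $r$-uniform hypergraph $G$ consists of a finite vertex set $V(G)=\{1,\dots,n\}$ and a set $E(G)$ of $r$-element subsets of $V(G)$ (edges). The degree of a vertex is the number of edges containing it; a vertex is isolated if its degree is $0$. For $\bm{x}\in\mathbb{R}^n$ let $P_G(\bm{x})=r\sum_{\{i_1,\ldots,i_r\}\in E(G)}x_{i_1}\cdots x_{i_r}$, and for real $p\ge1$ let $\|\bm{x}\|_p=(|x_1|^p+\cdots+|x_n|^p)^{1/p}$. The $p$-spectral radius of $G$ is $\lambda^{(p)}(G)=\max_{\|\bm{x}\|_p=1}P_G(\bm{x})$. *)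

(* Defs.v *)
From mathcomp Require Import all_boot all_order all_algebra.
From mathcomp Require Import all_classical all_reals all_analysis.

Set Implicit Arguments.
Unset Strict Implicit.
Unset Printing Implicit Defensive.

Import Order.TTheory GRing.Theory Num.Theory.
Import numFieldNormedType.Exports.

Local Open Scope classical_set_scope.
Local Open Scope ring_scope.

Record hypergraph (n r : nat) := Hypergraph {
  edges : {set {set 'I_n}};
  edges_uniform : forall e, e \in edges -> #|e| = r }.

Definition degree n r (G : hypergraph n r) (v : 'I_n) : nat :=
  #|[set e in edges G | v \in e]%SET|.

Definition isolated_vertex n r (G : hypergraph n r) (v : 'I_n) : bool :=
  degree G v == 0%N.

Definition max_degree n r (G : hypergraph n r) : nat :=
  \max_(v < n) degree G v.

(* Every degree is at most the number of edges, so using that number as the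
   neutral element of minn does not affect the minimum when n > 0. *)
Definition min_degree n r (G : hypergraph n r) : nat :=
  \big[minn/#|edges G|]_(v < n) degree G v.

Definition polynomial_form (R : realType) n r (G : hypergraph n r)
    (x : 'rV[R]_n) : R :=
  r%:R * \sum_(e in edges G) \prod_(i in e) x 0 i.

Definition pnorm (R : realType) n (p : R) (x : 'rV[R]_n) : R :=
  (\sum_(i < n) `|x 0 i| `^ p) `^ p^-1.

(* For n > 0 and p >= 1 the supremum is a maximum: see
   [p_spectral_radius_max]. *)
Definition p_spectral_radius (R : realType) n r (G : hypergraph n r) (p : R)
    : R :=
  sup [set polynomial_form G x | x in [set x : 'rV[R]_n | pnorm p x = 1]].

Lemma min_degreeP n r (G : hypergraph n r) : (0 < n)%N ->
  (exists v, degree G v = min_degree G) /\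
  (forall v, (min_degree G <= degree G v)%N).
Proof.
move=> n0; have le_min v : (min_degree G <= degree G v)%N.
  rewrite /min_degree; have := mem_index_enum v.
  elim: (index_enum _) => // w s IHs; rewrite big_cons geq_min inE.
  by case/predU1P => [<-|/IHs ->]; rewrite ?leqnn ?orbT.
split=> //; have [v _ vmin] := @arg_minnP _ (Ordinal n0) predT (degree G) isT.
exists v; apply/eqP; rewrite eqn_leq le_min andbT /min_degree.
elim/big_ind: _ => [|a b va vb|i _]; last exact: vmin.
- by apply: subset_leq_card; apply/fintype.subsetP => e; rewrite inE => /andP[].
- by rewrite leq_min va vb.
Qed.

Lemma continuous_normr_powR (R : realType) (p : R) : 0 < p ->
  continuous (fun t : R => `|t| `^ p).
Proof.
move=> p0 t; have [->|t0] := eqVneq t 0.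
  apply/cvgrPdist_lt => e e0; rewrite normr0 powR0 ?gt_eqF//.
  near=> u; rewrite sub0r normrN ger0_norm ?powR_ge0//.
  have -> : e = (e `^ p^-1) `^ p.
    by rewrite -powRrM mulVf ?gt_eqF// powRr1// ltW.
  apply: gt0_ltr_powR; rewrite ?nnegrE ?powR_ge0//.
  by near: u; apply: (@cvgr0_norm_lt _ _ _ _ _ id) => //; exact: powR_gt0.
apply: (@continuous_comp _ _ _ (fun t : R => `|t|) (fun t : R => t `^ p)).
  exact: norm_continuous.
apply: differentiable_continuous; apply/derivable1_diffP.
by apply: derivable_powR; rewrite in_itv/= andbT normr_gt0.
Unshelve. all: by end_near. Qed.

Lemma pnorm_eq1 (R : realType) n (p : R) (x : 'rV[R]_n) : 0 < p ->
  (pnorm p x = 1) <-> (\sum_(i < n) `|x 0 i| `^ p = 1).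
Proof.
move=> p0; rewrite /pnorm; set s := \sum_(i < n) _.
have s0 : 0 <= s by apply: sumr_ge0 => i _; exact: powR_ge0.
split=> [s1|->]; last by rewrite powR1.
have := congr1 (fun t : R => t `^ p) s1.
by rewrite -powRrM mulVf ?gt_eqF// powRr1// powR1.
Qed.

Lemma p_spectral_radius_max (R : realType) n r (G : hypergraph n r) (p : R) :
  (0 < n)%N -> 1 <= p ->
  (exists2 x : 'rV[R]_n, pnorm p x = 1 &
     polynomial_form G x = p_spectral_radius G p) /\
  (forall x : 'rV[R]_n, pnorm p x = 1 ->
     polynomial_form G x <= p_spectral_radius G p).
Proof.
move=> n0 p1; have p0 : 0 < p := lt_le_trans ltr01 p1.
pose A := [set x : 'rV[R]_n | pnorm p x = 1].
have Aneq0 : A !=set0.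
  exists (delta_mx 0 (Ordinal n0)); apply/(pnorm_eq1 _ p0).
  rewrite (bigD1 (Ordinal n0)) //= big1 ?addr0.
    by rewrite mxE !eqxx normr1 powR1.
  by move=> i /negPf i0; rewrite mxE i0 andbF normr0 powR0 ?gt_eqF.
have cA : compact A.
  apply: bounded_closed_compact.
    exists 1; split=> // M M1 x /(pnorm_eq1 _ p0) x1.
    apply: le_trans (ltW M1); rewrite [leLHS]/Num.norm/= mx_normrE.
    apply/bigmax_leP; split=> //= -[a i] _ /=; rewrite (ord1 a).
    suff : `|x 0 i| `^ p <= 1 `^ p.
      by apply: contraTT; rewrite -!ltNge => h; apply: gt0_ltr_powR;
        rewrite ?nnegrE.
    rewrite powR1 -x1 (bigD1 i)//= lerDl.
    by apply: sumr_ge0 => j _; exact: powR_ge0.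
  have -> : A = (fun x : 'rV[R]_n => \sum_(i < n) `|x 0 i| `^ p) @^-1`
                [set x | x = 1].
    by apply/seteqP; split=> x /= /(pnorm_eq1 _ p0).
  apply: preimage_closed; last exact: closed_eq.
  move=> x _; move: x; apply: (@continuous_big _ _ _ _ _ add_continuous).
  move=> i _ x.
  apply: (@continuous_comp _ _ _ (fun x : 'rV[R]_n => x 0 i)
    (fun t : R => `|t| `^ p)); first exact: coord_continuous.
  exact: continuous_normr_powR.
have cP : continuous (@polynomial_form R n r G).
  have cS : continuous (fun x : 'rV[R]_n =>
      \sum_(e in edges G) \prod_(i in e) x 0 i).
    apply: (@continuous_big _ _ _ _ _ add_continuous) => e _.
    apply: (@continuous_big _ _ _ _ _ mul_continuous) => i _.
    exact: coord_continuous.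
  move=> x; have cst : {for x, continuous (fun=> r%:R : R)} by apply: cst_continuous.
  exact: continuousM cst (cS x).
have [c] := EVT_max_rV Aneq0 cA (continuous_subspaceT cP).
rewrite inE => Ac cmax.
have ubP : ubound [set polynomial_form G x | x in A] (polynomial_form G c).
  by move=> _ [x Ax <-]; apply: cmax; rewrite inE.
have supE : p_spectral_radius G p = polynomial_form G c.
  apply/le_anti/andP; split.
    by apply: ge_sup => //; exists (polynomial_form G c), c.
  by apply: ub_le_sup; [exists (polynomial_form G c)|exists c].
split; first by exists c.
by move=> x Ax; rewrite supE; apply: cmax; rewrite inE.
Qed.

(* Main.v *)
(* Write u(p) = 1 - r/p and let a_i = x_i^p for a maximizer x > 0 of P_G on the
   unit p-sphere; set h = sum_i a_i ln a_i.  The Lagrange equations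
   sum_(e containing i) prod_(j in e) x_j = lambda(p) a_i, read at the smallest
   and at the largest a_i, give
     delta exp(- u(p) h) <= lambda(p) <= Delta exp(- u(p) h).
   For another exponent q the vector (a_i^(1/q)) is admissible, and Jensen's
   inequality for exp together with the Lagrange equations gives
     lambda(q) >= lambda(p) exp((r/q - r/p) h).
   Eliminating h between these estimates compares ln(lambda / Delta) / u, resp.
   ln(lambda / delta) / u, at p and at q. *)
Require Import Defs.
From mathcomp Require Import all_boot all_order all_algebra.
From mathcomp Require Import all_classical all_reals all_analysis.
From mathcomp Require Import ring lra.
Import Order.TTheory GRing.Theory Num.Theory.
Local Open Scope ring_scope.

(** * Convexity of the exponential and a first-order condition *)

(** With s = ln u, this is the combination with weights c and 1 - c of the tangent bound exp t >= 1
    + t at t = s(1 - c) and at t = -sc; the terms linear in s cancel. *)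
Lemma powR_Bernoulli (R : realType) (u c : R) : 0 < u -> 0 <= c <= 1 ->
  u `^ c <= 1 + c * (u - 1).
Proof.
move=> u0 /andP[c0 c1]; rewrite -[u]lnK ?posrE// -expRM.
move: (ln u) => s {u u0}.
have h1 : expR (s * c) * (1 + s * (1 - c)) <= expR s.
  rewrite [leRHS](_ : _ = expR (s * c) * expR (s * (1 - c))).
    by rewrite ler_pM2l ?expR_gt0// expR_ge1Dx.
  by rewrite -expRD; congr expR; ring.
have h2 : expR (s * c) * (1 - s * c) <= 1.
  rewrite [leRHS](_ : _ = expR (s * c) * expR (- (s * c))).
    by rewrite ler_pM2l ?expR_gt0// expR_ge1Dx.
  by rewrite -expRD subrr expR0.
set E := expR (s * c) in h1 h2 *.
have := lerD (ler_wpM2l c0 h1) (ler_wpM2l (_ : 0 <= 1 - c) h2).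
rewrite subr_ge0 => /(_ c1); lra.
Qed.

(** The hypothesis says that c exp(ps) - pS exp(s) is minimal at s = 0, where its derivative is p(c
    - S). *)
Lemma eq_of_expR_minimum (R : realType) (p S c : R) : 0 < p ->
  (forall s, p * S * (expR s - 1) <= c * (expR (p * s) - 1)) -> S = c.
Proof.
move=> p0 H.
pose f : R -> R := c \*: (expR \o (p \*: id)) - (p * S) \*: expR.
have df (t : R) :
    is_derive t 1 f (c * (expR (p * t) * (p * 1)) - p * S * expR t).
  by apply: is_derive_eq.
have d0 : is_derive (0 : R) 1 f 0.
  apply: (@derive1_at_min _ _ (-1) 1).
  - by lra.
  - by move=> t _; apply: ex_derive.
  - by rewrite in_itv/=; lra.
  - move=> t _; rewrite /f !fctE /= /GRing.scale /= mulr0 expR0.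
    by have := H t; lra.
have := @derive_val _ _ _ _ _ _ _ d0; rewrite (@derive_val _ _ _ _ _ _ _ (df 0)).
rewrite /GRing.scale /= mulr0 expR0 => /eqP.
rewrite [_ - _](_ : _ = p * (c - S)); last by ring.
by rewrite mulf_eq0 gt_eqF //= subr_eq0 => /eqP.
Qed.

(** * Homogeneity and nonnegative maximizers *)

Lemma polynomial_formZ (R : realType) n r (G : hypergraph n r) (c : R)
    (x : 'rV[R]_n) :
  polynomial_form G (c *: x) = c ^+ r * polynomial_form G x.
Proof.
rewrite /polynomial_form mulrCA; congr (_ * _); rewrite mulr_sumr.
apply: eq_bigr => e /edges_uniform eG.
rewrite -[in c ^+ r]eG -prodr_const -big_split /=.
by apply: eq_bigr => i _; rewrite mxE.
Qed.

(** Taking absolute values keeps the norm and cannot decrease the form. *)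
Lemma nonneg_maximizer (R : realType) n r (G : hypergraph n r) (p : R) :
  (0 < n)%N -> 1 <= p ->
  exists x : 'rV[R]_n, [/\ forall i, 0 <= x 0 i, \sum_i x 0 i `^ p = 1 &
    polynomial_form G x = p_spectral_radius G p].
Proof.
move=> n0 p1; have p0 : 0 < p by lra.
have [[x x1 xE] xmax] := @p_spectral_radius_max R n r G p n0 p1.
exists (\row_i `|x 0 i|); split.
- by move=> i; rewrite mxE.
- by under eq_bigr do rewrite mxE; apply/pnorm_eq1.
- apply/le_anti/andP; split.
    apply: xmax; apply/pnorm_eq1 => //; rewrite -[RHS]((pnorm_eq1 x p0).1 x1).
    by apply: eq_bigr => i _; rewrite mxE normr_id.
  rewrite -xE ler_wpM2l// ler_sum// => e _; apply: le_trans (ler_norm _) _.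
  by rewrite normr_prod ler_prod// => i _; rewrite mxE lexx normr_ge0.
Qed.

(** Homogeneity gives the factor N^(r/p), where N is the sum of the p-th powers; Bernoulli with r/p
    <= 1 replaces it by its tangent at N = 1. Being linear in N, the bound suits perturbations of a
    maximizer. *)
Lemma polynomial_form_le (R : realType) n r (G : hypergraph n r) (p : R)
    (x : 'rV[R]_n) : (0 < n)%N -> 1 <= p -> r%:R <= p ->
  (forall i, 0 <= x 0 i) -> 0 < \sum_i x 0 i `^ p ->
  polynomial_form G x <=
    p_spectral_radius G p * (1 + r%:R / p * (\sum_i x 0 i `^ p - 1)).
Proof.
move=> n0 p1 rp x0; set N := \sum_i _ => N0; have p0 : 0 < p by lra.
have lam0 : 0 <= p_spectral_radius G p.
  have [y [y0 _ <-]] := @nonneg_maximizer R n r G p n0 p1.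
  by rewrite mulr_ge0// sumr_ge0// => e _; rewrite prodr_ge0.
have [_ xmax] := @p_spectral_radius_max R n r G p n0 p1.
have c0 : 0 < N `^ p^-1 by rewrite powR_gt0.
have -> : x = N `^ p^-1 *: ((N `^ p^-1)^-1 *: x).
  by rewrite scalerA mulfV ?gt_eqF// scale1r.
rewrite polynomial_formZ mulrC ler_pM ?exprn_ge0 ?powR_ge0//.
- by rewrite mulr_ge0// sumr_ge0// => e _; rewrite prodr_ge0// => i _;
    rewrite mxE mulr_ge0// invr_ge0 powR_ge0.
- apply: xmax; apply/pnorm_eq1 => //.
  under eq_bigr => i _ do rewrite mxE ger0_norm ?mulr_ge0 ?invr_ge0 ?powR_ge0//
    powRM ?invr_ge0 ?powR_ge0// -powRN -powRrM mulNr mulVf ?gt_eqF//.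
  by rewrite -mulr_sumr powR_inv1 ?(ltW N0)// mulVf// gt_eqF.
- rewrite -powR_mulrn ?powR_ge0// -powRrM [_^-1 * _]mulrC.
  by apply: powR_Bernoulli => //; rewrite divr_ge0 ?ler0n ?(ltW p0)//= ler_pdivrMr ?mul1r.
Qed.

(** * Lagrange equations and positivity of maximizers *)

Lemma prod_if_eq (R : realType) n (e : {set 'I_n}) (i : 'I_n) (c : R) :
  \prod_(j in e) (if j == i then c else 1) = if i \in e then c else 1.
Proof.
have [ie|ie] := boolP (i \in e).
  by rewrite (bigD1 i)//= eqxx big1 ?mulr1// => j /andP[_ /negPf ->].
by rewrite big1// => j je; case: eqP => // ji; rewrite -ji je in ie.
Qed.

(* Scaling the [i]-th coordinate of a maximizer by [expR s] perturbs both sides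
   of [polynomial_form_le]; equality holds at [s = 0]. *)
Lemma maximizer_eigenvector (R : realType) n r (G : hypergraph n r) (p : R)
    (x : 'rV[R]_n) : (0 < n)%N -> (0 < r)%N -> 1 <= p -> r%:R <= p ->
  (forall i, 0 <= x 0 i) -> \sum_i x 0 i `^ p = 1 ->
  polynomial_form G x = p_spectral_radius G p ->
  forall i, \sum_(e in edges G | i \in e) \prod_(j in e) x 0 j =
    p_spectral_radius G p * x 0 i `^ p.
Proof.
move=> n0 r0 p1 rp x0 x1 xE i; have p0 : 0 < p by lra.
set lam := p_spectral_radius G p in xE *; set S := \sum_(e in _ | _) _.
have rR0 : 0 < r%:R :> R by rewrite ltr0n.
apply: (@eq_of_expR_minimum _ p) => // s.
pose y : 'rV[R]_n := \row_j ((if j == i then expR s else 1) * x 0 j).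
have yP : polynomial_form G y = lam + r%:R * ((expR s - 1) * S).
  rewrite -xE /polynomial_form -mulrDr; congr (_ * _).
  rewrite /S mulr_sumr big_mkcondr /= -big_split /=; apply: eq_bigr => e _.
  under eq_bigr => j _ do rewrite mxE; rewrite big_split /= prod_if_eq.
  by case: ifP => _; ring.
have yN : \sum_j y 0 j `^ p = 1 + (expR (p * s) - 1) * x 0 i `^ p.
  rewrite -[X in X + _]x1 (bigD1 i)//= [in RHS](bigD1 i)//= mxE eqxx powRM ?expR_ge0//.
  rewrite -expRM [s * p]mulrC.
  rewrite (eq_bigr (fun j => x 0 j `^ p)) => [|j /negPf ji].
    by set T := \sum_(_ | _) _; ring.
  by rewrite mxE ji mul1r.
have xi0 := powR_ge0 (x 0 i) p.
have xi1 : x 0 i `^ p <= 1.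
  by rewrite -x1 (bigD1 i)//= lerDl sumr_ge0// => j _; exact: powR_ge0.
have := @polynomial_form_le R n r G p y n0 p1 rp; rewrite yP yN -/lam.
set E := expR (p * s); have E0 : 0 < E := expR_gt0 _.
set X := x 0 i `^ p in xi0 xi1 *.
have y0 j : 0 <= y 0 j.
  by rewrite mxE mulr_ge0//; case: ifP => // _; exact: expR_ge0.
(* The perturbed norm stays positive because [X <= 1] and [E > 0]. *)
move=> /(_ y0); have N0 : 0 < 1 + (E - 1) * X.
  have [->|Xn0] := eqVneq X 0; first by rewrite mulr0 addr0.
  have : 0 < E * X by rewrite mulr_gt0// lt_neqAle eq_sym Xn0.
  lra.
move=> /(_ N0); rewrite mulrDr mulr1 lerD2l.
(* Cancelling r leaves the hypothesis of [eq_of_expR_minimum] with c = [lam * X]. *)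
rewrite [leRHS](_ : _ = r%:R * (lam * X * (E - 1) / p)); last first.
  by field; rewrite gt_eqF.
rewrite ler_pM2l// ler_pdivlMr//; lra.
Qed.

Lemma maximizer_gt0 (R : realType) n r (G : hypergraph n r) (p : R)
    (x : 'rV[R]_n) : (forall v, ~~ isolated_vertex G v) ->
  (0 < r)%N -> 1 <= p -> r%:R < p ->
  (forall i, 0 <= x 0 i) -> \sum_i x 0 i `^ p = 1 ->
  polynomial_form G x = p_spectral_radius G p ->
  forall i, 0 < x 0 i.
Proof.
move=> noiso r0 p1 rp x0 x1 xE v; have p0 : 0 < p by lra.
have n0 : (0 < n)%N by case: (n) v => [[]|].
rewrite lt_neqAle x0 andbT eq_sym; apply/negP => /eqP xv0.
have [e] : exists e, e \in [set e in edges G | v \in e]%SET.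
  by apply/card_gt0P; rewrite lt0n; exact: noiso v.
rewrite inE => /andP[eG ve].
have rR0 : 0 < r%:R :> R by rewrite ltr0n.
set lam := p_spectral_radius G p in xE.
have lam0 : 0 <= lam.
  by rewrite -xE mulr_ge0// sumr_ge0// => e' _; rewrite prodr_ge0.
pose c := \prod_(j in e | x 0 j != 0) x 0 j.
have c0 : 0 < c.
  by rewrite prodr_gt0// => j /andP[_ xj]; rewrite lt_neqAle eq_sym xj x0.
pose K := lam * n%:R / p.
have K0 : 0 <= K by rewrite divr_ge0 ?mulr_ge0 ?(ltW p0).
(* filling the zero coordinates with [eps] gains order [eps ^ r] in the form
   but costs only order [eps ^ p] in the norm *)
suff H (eps : R) : 0 < eps <= 1 -> c <= K * eps `^ (p - r%:R).
  (* Choosing eps with eps^(p - r) <= c/(K + 1) makes the right-hand side smaller than c, a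
     contradiction. *)
  pose d := c / (K + 1); have d0 : 0 < d by rewrite divr_gt0//; lra.
  have q0 : 0 < p - r%:R by rewrite subr_gt0.
  have m0 : 0 < Num.min 1 (d `^ (p - r%:R)^-1) by rewrite lt_min ltr01 powR_gt0.
  have := H (Num.min 1 (d `^ (p - r%:R)^-1)).
  rewrite m0 ge_min lexx => /(_ isT).
  have : Num.min 1 (d `^ (p - r%:R)^-1) `^ (p - r%:R) <= d.
    rewrite -[leRHS](powRr1 (ltW d0)) -[in leRHS](mulVf (lt0r_neq0 q0)) powRrM.
    apply: ge0_ler_powR; rewrite ?nnegrE ?(ltW q0) ?(ltW m0) ?powR_ge0//.
    by rewrite ge_min lexx orbT.
  move=> /(ler_wpM2l K0) h1 /le_trans/(_ h1).
  apply/negP; rewrite -ltNge /d mulrCA gtr_pMr// ltr_pdivrMr; lra.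
case/andP=> eps0 eps1.
pose y : 'rV[R]_n := \row_j (if x 0 j == 0 then eps else x 0 j).
have y0 j : 0 <= y 0 j by rewrite mxE; case: ifP => // _; exact: ltW.
have xy j : x 0 j <= y 0 j by rewrite mxE; case: eqP => // ->; exact: ltW.
have ye : c * eps ^+ r <= \prod_(j in e) y 0 j.
  rewrite (bigID (fun j => x 0 j != 0))/=; apply: ler_pM.
  - exact: ltW.
  - by rewrite exprn_ge0// ltW.
  - by rewrite le_eqVlt; apply/orP; left; apply/eqP; apply: eq_bigr => j /andP[_ /negPf];
      rewrite mxE => ->.
  (* At most r coordinates of [e] are filled, and [eps <= 1], so their product is at least eps^r. *)
  - rewrite (eq_bigr (fun=> eps)); last first.
      by move=> j /andP[_ /negPn xj]; rewrite mxE xj.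
    rewrite prodr_const ler_wiXn2l ?(ltW eps0)// -(edges_uniform eG).
    by apply: subset_leq_card; apply/fintype.subsetP => j /andP[].
have yP : lam + r%:R * (c * eps ^+ r) <= polynomial_form G y.
  rewrite -xE -mulrDr ler_wpM2l// (bigD1 e)//= [leRHS](bigD1 e)//=.
  (* The edge [e] contributed nothing before, since it contains [v]; its whole new product is
     gain. *)
  rewrite [X in X + _ + _](_ : _ = 0) ?add0r; last first.
    by rewrite (bigD1 v)//= xv0 mul0r.
  rewrite addrC lerD// ler_sum// => e' _; apply: ler_prod => j _.
  by rewrite x0 xy.
have yNle : \sum_j y 0 j `^ p - 1 <= n%:R * eps `^ p.
  rewrite lerBlDl -[X in _ <= X + _]x1 mulr_natl -[in _ *+ n](card_ord n) -sumr_const.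
  rewrite -big_split /= ler_sum// => j _; rewrite mxE.
  by case: ifP => [_|_]; rewrite ?lerDl ?lerDr powR_ge0.
have yNge : 1 <= \sum_j y 0 j `^ p.
  rewrite -x1 ler_sum// => j _; apply: ge0_ler_powR; rewrite ?nnegrE//.
  exact: ltW.
have := @polynomial_form_le R n r G p y n0 p1 (ltW rp) y0 (lt_le_trans ltr01 yNge).
rewrite -/lam => /(le_trans yP); rewrite mulrDr mulr1 lerD2l => h.
have {}h : r%:R * (c * eps ^+ r) <= lam * (r%:R / p * (n%:R * eps `^ p)).
  apply: le_trans h _; rewrite ler_wpM2l// ler_wpM2l// divr_ge0//; exact: ltW.
move: h; rewrite [leRHS](_ : _ = r%:R * (K * eps `^ p)); last first.
  by rewrite /K; field; rewrite gt_eqF.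
have -> : eps `^ p = eps `^ (p - r%:R) * eps ^+ r.
  by rewrite -powR_mulrn ?(ltW eps0)// -powRD ?subrK// (gt_eqF p0).
by rewrite ler_pM2l// mulrA ler_pM2r// exprn_gt0.
Qed.

(** * Logarithmic coordinates and entropy bounds *)

(** Positivity permits b_i = p ln x_i, the logarithm of a_i = x_i^p. The normalization of b then no
    longer mentions p. *)
Lemma log_maximizer (R : realType) n r (G : hypergraph n r) (p : R) :
  (forall v, ~~ isolated_vertex G v) -> (0 < n)%N -> (0 < r)%N ->
  1 <= p -> r%:R < p ->
  exists b : 'I_n -> R, \sum_i expR (b i) = 1 /\
    forall i, \sum_(e in edges G | i \in e) expR ((\sum_(j in e) b j) / p) =
      p_spectral_radius G p * expR (b i).
Proof.
move=> noiso n0 r0 p1 rp; have p0 : 0 < p by lra.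
have [x [x0 x1 xE]] := @nonneg_maximizer R n r G p n0 p1.
have xpos := @maximizer_gt0 R n r G p x noiso r0 p1 rp x0 x1 xE.
have bE i : expR (p * ln (x 0 i)) = x 0 i `^ p.
  by rewrite mulrC expRM lnK// posrE.
exists (fun i => p * ln (x 0 i)); split.
  by rewrite -x1; apply: eq_bigr => i _.
move=> i; rewrite bE -(@maximizer_eigenvector R n r G p x)// ?(ltW rp)//.
apply: eq_bigr => e _; rewrite -mulr_sumr mulrC mulKf ?gt_eqF// expR_sum.
by apply: eq_bigr => j _; rewrite lnK// posrE.
Qed.

(** The test vector is exp(b_i / p). A [b] obtained from one exponent can thus be tested at any
    other. *)
Lemma sum_expR_le (R : realType) n r (G : hypergraph n r) (p : R)
    (b : 'I_n -> R) : (0 < n)%N -> 1 <= p -> \sum_i expR (b i) = 1 ->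
  r%:R * (\sum_(e in edges G) expR ((\sum_(j in e) b j) / p)) <=
    p_spectral_radius G p.
Proof.
move=> n0 p1 b1; have p0 : 0 < p by lra.
have [_ xmax] := @p_spectral_radius_max R n r G p n0 p1.
have := xmax (\row_i expR (b i / p)).
rewrite /polynomial_form; under eq_bigr => e _.
  under eq_bigr => j _ do rewrite mxE.
  rewrite -expR_sum -mulr_suml; over.
apply; apply/pnorm_eq1 => //; rewrite -[RHS]b1; apply: eq_bigr => i _.
by rewrite mxE ger0_norm ?expR_ge0// -expRM divfK// gt_eqF.
Qed.

(* The witness is [h = sum_i a_i ln a_i] for a maximizer [x_i = a_i^(1/p)]. *)
Lemma entropy_bounds (R : realType) n r (G : hypergraph n r) (p : R) :
  (forall v, ~~ isolated_vertex G v) -> (0 < n)%N -> (0 < r)%N ->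
  r%:R < p ->
  exists h : R,
    [/\ (min_degree G)%:R * expR (- (1 - r%:R / p) * h) <= p_spectral_radius G p,
        p_spectral_radius G p <= (max_degree G)%:R * expR (- (1 - r%:R / p) * h)
      & forall q : R, r%:R < q ->
        p_spectral_radius G p * expR ((r%:R / q - r%:R / p) * h) <=
          p_spectral_radius G q].
Proof.
move=> noiso n0 r0 rp.
have r1 : 1 <= r%:R :> R by rewrite ler1n.
have p1 : 1 <= p by lra. have p0 : 0 < p by lra.
have [b [b1 bE]] := @log_maximizer R n r G p noiso n0 r0 p1 rp.
set lam := p_spectral_radius G p in bE *.
pose h := \sum_i expR (b i) * b i; exists h.
pose u := 1 - r%:R / p; rewrite -/u.
have u0 : 0 < u by rewrite subr_gt0 ltr_pdivrMr// mul1r.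
have le_wmean (c : R) : (forall i, c <= b i) -> c <= h.
  move=> cb; rewrite -[c]mul1r -b1 mulr_suml ler_sum// => i _.
  by rewrite ler_pM2l ?expR_gt0.
have ge_wmean (c : R) : (forall i, b i <= c) -> h <= c.
  move=> cb; rewrite -[c]mul1r -b1 mulr_suml ler_sum// => i _.
  by rewrite ler_pM2l ?expR_gt0.
have degE i (c : R) : \sum_(e in edges G | i \in e) c = (degree G i)%:R * c.
  rewrite /degree mulr_natl -sumr_const; apply: eq_bigl => e.
  by rewrite inE.
have scale (d c : R) : d * expR (- u * c) = d * expR (c * r%:R / p) / expR c.
  by rewrite -mulrA -expRN -expRD; congr (_ * expR _); rewrite /u; ring.
split.
- have [m _ mP] := @Order.TotalTheory.arg_minP _ _ _ (Ordinal n0) predT b isT.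
  apply: (@le_trans _ _ ((min_degree G)%:R * expR (- u * b m))).
    rewrite ler_wpM2l// ler_expR ler_nM2l ?oppr_lt0//.
    by apply: le_wmean => i; exact: mP.
  rewrite scale ler_pdivrMr ?expR_gt0// -bE.
  apply: (@le_trans _ _ ((degree G m)%:R * expR (b m * r%:R / p))).
    by rewrite ler_wpM2r ?expR_ge0// ler_nat; apply: (min_degreeP _ n0).2.
  rewrite -degE ler_sum// => e /andP[eG _].
  rewrite ler_expR ler_pM2r ?invr_gt0// mulr_natr -(edges_uniform eG) -sumr_const.
  by apply: ler_sum => j _; exact: mP.
- have [m _ mP] := @Order.TotalTheory.arg_maxP _ _ _ (Ordinal n0) predT b isT.
  apply: (@le_trans _ _ ((max_degree G)%:R * expR (- u * b m))); last first.
    rewrite ler_wpM2l// ler_expR ler_nM2l ?oppr_lt0//.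
    by apply: ge_wmean => i; exact: mP.
  rewrite scale ler_pdivlMr ?expR_gt0// -bE.
  apply: (@le_trans _ _ ((degree G m)%:R * expR (b m * r%:R / p))); last first.
    by rewrite ler_wpM2r ?expR_ge0// ler_nat /max_degree leq_bigmax.
  rewrite -degE ler_sum// => e /andP[eG _].
  rewrite ler_expR ler_pM2r ?invr_gt0// mulr_natr -(edges_uniform eG) -sumr_const.
  by apply: ler_sum => j _; exact: mP.
- move=> q rq; have q1 : 1 <= q by lra. have q0 : 0 < q by lra.
  apply: le_trans (@sum_expR_le R n r G q b n0 q1 b1).
  pose z (e : {set 'I_n}) := expR ((\sum_(j in e) b j) / p).
  (* Double counting: exchange edges and vertices, then apply the eigenvalue equation at each
     vertex. It is used with c = 1 and with c = [b]. *)
  have dbl (c : 'I_n -> R) : \sum_(e in edges G) z e * (\sum_(j in e) c j) =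
      lam * \sum_j expR (b j) * c j.
    under eq_bigr do rewrite mulr_sumr.
    rewrite (exchange_big_dep predT)//= mulr_sumr; apply: eq_bigr => j _.
    by rewrite -mulr_suml bE mulrA.
  have zsum : r%:R * \sum_(e in edges G) z e = lam.
    have := dbl (fun=> 1); under [in RHS]eq_bigr do rewrite mulr1.
    rewrite b1 mulr1 => <-; rewrite mulr_sumr; apply: eq_bigr => e eG.
    by rewrite sumr_const (edges_uniform eG) mulrC.
  set d := r%:R / q - _.
  (* Centring the exponent at [d * h], its mean under the weights [z], makes the linear terms of exp
     t >= 1 + t cancel after summation. *)
  have tangent (e : {set 'I_n}) : z e * (1 + (q^-1 - p^-1) * \sum_(j in e) b j - d * h) <=
      expR ((\sum_(j in e) b j) / q) / expR (d * h).
    rewrite -expRN -expRD [leRHS](_ : _ =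
      z e * expR ((q^-1 - p^-1) * \sum_(j in e) b j - d * h)).
      by rewrite ler_wpM2l ?expR_ge0// -addrA expR_ge1Dx.
    by rewrite -expRD; congr expR; ring.
  rewrite -ler_pdivlMr ?expR_gt0// -mulrA mulr_suml.
  apply: (@le_trans _ _ (r%:R * \sum_(e in edges G)
      z e * (1 + (q^-1 - p^-1) * (\sum_(j in e) b j) - d * h))); last first.
    by rewrite ler_wpM2l// ler_sum.
  under eq_bigr => e _ do
    rewrite addrAC mulrDr mulrCA [z e * (1 - _)]mulrC.
  rewrite big_split /= -!mulr_sumr dbl -/h.
  move: zsum; set Z := \sum_(_ in _) z _ => <-.
  by rewrite /d le_eqVlt; apply/orP; left; apply/eqP; ring.
Qed.

(** * Monotonicity in the exponent *)

Theorem theorem3p5 (R : realType) (n r : nat) (G : hypergraph n r)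
    (noiso : forall v : 'I_n, ~~ isolated_vertex G v) :
  let f := fun p : R =>
    (p_spectral_radius G p / (max_degree G)%:R) `^ (p / (p - r%:R)) in
  let g := fun p : R =>
    (p_spectral_radius G p / (min_degree G)%:R) `^ (p / (p - r%:R)) in
  {in `]r%:R, +oo[ &, nondecreasing_fun f} /\
  {in `]r%:R, +oo[ &, nonincreasing_fun g}.
Proof.
move=> f g; have [n0|n0] := posnP n.
  (* the unit sphere is empty, so the spectral radius is the junk value [sup set0] *)
  subst n.
  have fgE (d : nat) (p : R) : p \in `]r%:R, +oo[ ->
      (p_spectral_radius G p / d%:R) `^ (p / (p - r%:R)) = 0.
    rewrite in_itv/= andbT => rp; have r0 : 0 <= r%:R :> R := ler0n _ _.
    have p0 : 0 < p := le_lt_trans r0 rp.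
    rewrite (_ : p_spectral_radius G p = 0) ?mul0r ?powR0//.
      (* The exponent has to be nonzero, as a zero base with exponent 0 gives 1. *)
      by rewrite mulf_neq0 ?invr_eq0 ?gt_eqF// subr_gt0.
    rewrite /p_spectral_radius (_ : [set x | _]%classic = set0) ?image_set0 ?sup0//.
    apply/seteqP; split=> x //= /(pnorm_eq1 _ p0).
    by rewrite big_ord0 => /eqP; rewrite eq_sym oner_eq0.
  have f0 p : p \in `]r%:R, +oo[ -> f p = 0 by move=> rp; apply: fgE.
  have g0 p : p \in `]r%:R, +oo[ -> g p = 0 by move=> rp; apply: fgE.
  by split=> p q rp rq _; [rewrite !f0|rewrite !g0].
have degv_gt0 v : (0 < degree G v)%N by rewrite lt0n; exact: noiso v.
have r0 : (0 < r)%N.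
  have /card_gt0P[e] := degv_gt0 (Ordinal n0).
  by rewrite inE => /andP[/edges_uniform <- ve]; apply/card_gt0P; exists (Ordinal n0).
have d0 : 0 < (min_degree G)%:R :> R.
  by have [[v <-] _] := min_degreeP G n0; rewrite ltr0n.
have D0 : 0 < (max_degree G)%:R :> R.
  by rewrite ltr0n (leq_trans (degv_gt0 (Ordinal n0)))// /max_degree leq_bigmax.
have lam0 (p : R) : r%:R < p -> 0 < p_spectral_radius G p.
  move=> /(@entropy_bounds R n r G p noiso n0 r0)[h [+ _ _]]; apply: lt_le_trans.
  by rewrite mulr_gt0// expR_gt0.
have rR0 : 0 < r%:R :> R by rewrite ltr0n.
pose u (p : R) := 1 - r%:R / p.
pose L (d p : R) := ln (p_spectral_radius G p / d).
have u0 p : r%:R < p -> 0 < u p.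
  by move=> rp; rewrite subr_gt0 ltr_pdivrMr ?mul1r// (lt_trans rR0).
have ule p q : r%:R < p -> p <= q -> u p <= u q.
  move=> rp pq; rewrite lerD2l lerN2 ler_wpM2l// lef_pV2 ?posrE//; lra.
(* Since p/(p - r) = 1/u(p), it suffices to compare the quotients L/u. *)
have powE (d p : R) : 0 < d -> r%:R < p ->
    (p_spectral_radius G p / d) `^ (p / (p - r%:R)) = expR (L d p / u p).
  move=> dpos rp; rewrite /powR gt_eqF ?divr_gt0 ?lam0// -/(L d p) mulrC.
  congr (expR (_ * _)); rewrite /u; field; lra.
have LD (d p c : R) : 0 < d -> r%:R < p ->
    (p_spectral_radius G p <= d * expR c) = (L d p <= c).
  move=> dpos rp; rewrite mulrC -ler_pdivrMr//.
  by rewrite -[in RHS]ler_expR /L lnK// posrE divr_gt0// lam0.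
have LG (d p c : R) : 0 < d -> r%:R < p ->
    (d * expR c <= p_spectral_radius G p) = (c <= L d p).
  move=> dpos rp; rewrite mulrC -ler_pdivlMr//.
  by rewrite -[in RHS]ler_expR /L lnK// posrE divr_gt0// lam0.
have Ltr (d p q c : R) : 0 < d -> r%:R < p -> r%:R < q ->
    p_spectral_radius G p * expR c <= p_spectral_radius G q ->
    L d p + c <= L d q.
  move=> dpos rp rq; rewrite -LG// expRD /L lnK ?posrE ?divr_gt0 ?lam0//.
  by rewrite mulrA mulrCA divff ?gt_eqF// mulr1.
have fE p : r%:R < p -> f p = expR (L (max_degree G)%:R p / u p) by exact: powE.
have gE p : r%:R < p -> g p = expR (L (min_degree G)%:R p / u p) by exact: powE.
split=> p q; rewrite !in_itv/= !andbT => rp rq pq.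
(* The entropy is taken at the smaller exponent [p]. Adding [h1] and [h2] eliminates [h] and leaves
   A u(q) <= B u(p). *)
- rewrite fE// fE// ler_expR.
  have [h [_ hD hq]] := @entropy_bounds R n r G p noiso n0 r0 rp.
  move: hD (Ltr _ _ _ _ D0 rp rq (hq q rq)); rewrite LD// -/(u p).
  set A := L _ p; set B := L _ q => hA hB.
  have up := u0 _ rp; have uq := u0 _ rq; have upq := ule _ _ rp pq.
  rewrite ler_pdivrMr// mulrAC ler_pdivlMr//.
  have {}hB : A + (u p - u q) * h <= B by rewrite /u; lra.
  have h1 := ler_wpM2l (ltW up) hB.
  have h2 : 0 <= (u q - u p) * (- u p * h - A).
    by apply: mulr_ge0; rewrite subr_ge0; [exact: upq|exact: hA].
  lra.
(* Now the entropy is taken at the larger exponent [q] and transferred down to [p], so that the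
   lower bound on A is multiplied by u(q) - u(p) >= 0. *)
- rewrite gE// gE// ler_expR.
  have [h [hD _ hq]] := @entropy_bounds R n r G q noiso n0 r0 rq.
  move: hD (Ltr _ _ _ _ d0 rq rp (hq p rp)); rewrite LG// -/(u q).
  set A := L _ q; set B := L _ p => hA hB.
  have up := u0 _ rp; have uq := u0 _ rq; have upq := ule _ _ rp pq.
  rewrite ler_pdivrMr// mulrAC ler_pdivlMr//.
  have {}hB : A + (u q - u p) * h <= B by rewrite /u; lra.
  have h1 := ler_wpM2l (ltW uq) hB.
  have h2 : 0 <= (u q - u p) * (A - - u q * h).
    by apply: mulr_ge0; rewrite subr_ge0; [exact: upq|exact: hA].
  lra.
Qed.
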